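(* Let $d,N\in\mathbb{N}$, $0<\lambda<1$, $\epsilon\ge0$, and consider the adversarial pretraining problem $$\min_{\bm P,\bm Q\in[0,1]^{(d+1)\times(d+1)}}\ \mathbb{E}_{c\sim U([d]),\,\{(\bm x_n,y_n)\}_{n=1}^{N+1}\overset{\text{i.i.d.}}{\sim}\mathcal{D}^{\rm tr}_c}\Big[\max_{\|\bm\Delta\|_\infty\le\epsilon}-y_{N+1}[f(\bm Z;\bm P,\bm Q)]_{d+1,N+1}\Big].$$ Then a global minimizer is: (1) if $0\le\epsilon\le\frac{\lambda(\lambda(d-2)+4)}{2(\lambda(d-1)+2)}$: $\bm P=\bm P^{\rm std}:=\begin{bmatrix}\bm 0_{d,d+1}\\ \bm 1_{d+1}^\top\end{bmatrix}$ and $\bm Q=\bm Q^{\rm std}:=\begin{bmatrix}\bm 1_{d+1,d}&\bm 0_{d+1}\end{bmatrix}$; (2) if $\epsilon=\frac{1+(d-1)(\lambda/2)}{d}$: $\bm P=\bm P^{\rm adv}:=\begin{bmatrix}\bm 0_{d,d+1}\\ \bm 1_{d+1}^\top\end{bmatrix}$ and $\bm Q=\bm Q^{\rm adv}:=\begin{bmatrix}\bm I_d&\bm 0_d\\ \bm 0_d^\top&0\end{bmatrix}$; (3) if $\epsilon\ge\frac{\lambda}{2}+\frac32\,\frac{2-\lambda}{(d-1)\lambda^2+3}$: $\bm P=\bm 0_{d+1,d+1}$ and $\bm Q=\bm 0_{d+1,d+1}$.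
   Context: For $n\in\mathbb{N}$, $[n]:=\{1,\dots,n\}$. $U(\mathcal S)$ is the uniform distribution on a set $\mathcal S$. $\bm 1_{a}$, $\bm 1_{a,b}$, $\bm 0_a$, $\bm 0_{a,b}$, $\bm I_a$ denote the all-ones vector/matrix, the all-zeros vector/matrix and the identity. Training distributions: for $c\in[d]$ and $0<\lambda<1$, a sample $(\bm x,y)\sim\mathcal{D}^{\rm tr}_c$ with $\bm x\in\mathbb{R}^d$ is generated as follows: $y\sim U(\{\pm1\})$, $x_c=y$, and for each $i\ne c$, $x_i\sim U([0,\lambda])$ if $y=1$ and $x_i\sim U([-\lambda,0])$ if $y=-1$; given $y$, the coordinates $x_i$ are mutually independent. Transformer: given demonstrations $(\bm x_1,y_1),\dots,(\bm x_N,y_N)$, a query $\bm x_{N+1}\in\mathbb{R}^d$ and a perturbation $\bm\Delta\in\mathbb{R}^d$, let $\bm Z\in\mathbb{R}^{(d+1)\times(N+1)}$ be the matrix whose $n$-th column is $(\bm x_n^\top, y_n)^\top$ for $n\le N$ and whose last column is $((\bm x_{N+1}+\bm\Delta)^\top,0)^\top$. Let $\bm M:=\begin{bmatrix}\bm I_N&0\\0&0\end{bmatrix}\in\mathbb{R}^{(N+1)\times(N+1)}$ and, for $\bm P,\bm Q\in\mathbb{R}^{(d+1)\times(d+1)}$, $f(\bm Z;\bm P,\bm Q):=\frac1N\bm P\bm Z\bm M\bm Z^\top\bm Q\bm Z$. $[\cdot]_{d+1,N+1}$ denotes the $(d+1,N+1)$ entry. *)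

(* Defs.v *)
From HB Require Import structures.
From mathcomp Require Import all_boot all_order all_algebra.
From mathcomp Require Import all_classical all_reals all_analysis.
Set Implicit Arguments. Unset Strict Implicit. Unset Printing Implicit Defensive.
Import Order.TTheory GRing.Theory Num.Theory.
Import numFieldNormedType.Exports.
Local Open Scope classical_set_scope.
Local Open Scope ring_scope.

Section Defs.
Variable R : realType.

Definition ysgn (b : bool) : R := if b then 1 else -1.

Definition ext (d : nat) (v : 'I_d -> R) (last : R) (i : 'I_d.+1) : R :=
  match (insub (nat_of_ord i) : option 'I_d) with
  | Some k => v k
  | None => last
  end.

(* the prompt matrix Z : (d+1) x (N+1); columns 0..N-1 are the demonstrations,
   column N (= ord_max) is the perturbed query (x_{N+1} + Delta, 0). *)
Definition Zmat (d N : nat) (x : 'I_N.+1 -> 'I_d -> R) (y : 'I_N.+1 -> bool)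
  (Delta : 'I_d -> R) : 'M[R]_(d.+1, N.+1) :=
  \matrix_(i < d.+1, j < N.+1)
    if j == ord_max then ext (fun k => x j k + Delta k) 0 i
    else ext (x j) (ysgn (y j)) i.

Definition Mmat (N : nat) : 'M[R]_(N.+1) :=
  \matrix_(i < N.+1, j < N.+1) if (i == j) && (i != ord_max) then 1 else 0.

Definition ftf (d N : nat) (P Q : 'M[R]_(d.+1)) (Z : 'M[R]_(d.+1, N.+1))
  : 'M[R]_(d.+1, N.+1) :=
  (N%:R)^-1 *: (P *m Z *m Mmat N *m Z^T *m Q *m Z).

Definition adv_loss (d N : nat) (eps : R) (P Q : 'M[R]_(d.+1))
  (x : 'I_N.+1 -> 'I_d -> R) (y : 'I_N.+1 -> bool) : R :=
  sup [set r | exists Delta : 'I_d -> R,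
         (forall i, `|Delta i| <= eps) /\
         r = - ysgn (y ord_max) * ftf P Q (Zmat x y Delta) ord_max ord_max].

(* Expectation of one coordinate x_{n,i} given c and y_n under D^tr_c:
   x_{n,c} = y_n, otherwise U([0,lam]) if y_n = 1 and U([-lam,0]) if y_n = -1. *)
Definition coordE (d N : nat) (lam : R) (c : 'I_d) (y : 'I_N.+1 -> bool)
  (k : 'I_N.+1 * 'I_d) (g : R -> R) : R :=
  if k.2 == c then g (ysgn (y k.1))
  else lam^-1 * Rintegral (@lebesgue_measure R)
         (if y k.1 then [set` `[0, lam]] else [set` `[- lam, 0]]) g.

(* iterated (Fubini) expectation over independent coordinates listed in s *)
Fixpoint iterE (d N : nat) (lam : R) (c : 'I_d) (y : 'I_N.+1 -> bool)
  (s : seq ('I_N.+1 * 'I_d)) (F : ('I_N.+1 -> 'I_d -> R) -> R)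
  (x0 : 'I_N.+1 -> 'I_d -> R) : R :=
  match s with
  | [::] => F x0
  | k :: s' => coordE lam c y k (fun t =>
       iterE lam c y s' F (fun n i => if (n, i) == k then t else x0 n i))
  end.

Definition adv_risk (d N : nat) (lam eps : R) (P Q : 'M[R]_(d.+1)) : R :=
  (d%:R)^-1 * \sum_(c < d)
    (2 ^+ N.+1)^-1 * \sum_(y : {ffun 'I_N.+1 -> bool})
      iterE lam c y (enum [set: ('I_N.+1 * 'I_d)%type])
        (fun x => adv_loss eps P Q x y) (fun _ _ => 0).

Definition in01 (d : nat) (A : 'M[R]_(d.+1)) : Prop :=
  forall i j, 0 <= A i j <= 1.

Definition is_global_min (d N : nat) (lam eps : R) (P Q : 'M[R]_(d.+1)) : Prop :=
  in01 P /\ in01 Q /\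
  forall P' Q' : 'M[R]_(d.+1), in01 P' -> in01 Q' ->
    adv_risk N lam eps P Q <= adv_risk N lam eps P' Q'.

Definition Pstd (d : nat) : 'M[R]_(d.+1) :=
  \matrix_(i, j) if i == ord_max then 1 else 0.
Definition Qstd (d : nat) : 'M[R]_(d.+1) :=
  \matrix_(i, j) if j == ord_max then 0 else 1.
Definition Qadv (d : nat) : 'M[R]_(d.+1) :=
  \matrix_(i, j) if (i == j) && (i != ord_max) then 1 else 0.

End Defs.

(* Main.v *)
(** On the support of the data [y * x >= 0] coordinatewise, so the query enters
    linearly with nonnegative weights; the inner maximum is attained at
    [Delta = - y eps] and the loss equals
    [\sum_j weight_j * (eps - y * x_j)].  Taking expectations, the risk becomes
    a form [\sum_j \sum_k \sum_l p_k Q_lj W_j(k, l)], bilinear in the last row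
    [p] of [P] and in [Q], with, for [h = lam / 2] and [S_c] the matrix of second
    moments of [(y x, 1)] under task [c],
    [W_j = (eps - h) \sum_c S_c - (1 - h) S_j].
    For large [eps] all [W_j] are entrywise nonnegative, so [0] is optimal.
    For small [eps] the entries of [W_j] outside the rows and columns of [j] and
    of the label may be positive, but all row sums are nonpositive.  At the
    middle value [eps - h = (1 - h) / d]; with [P] all ones only the diagonal
    entries of [Q] are profitable, and what a smaller [p] could gain in the other
    columns is at most what it loses on the diagonal. *)
Require Import Defs.
From HB Require Import structures.
From mathcomp Require Import all_boot all_order all_algebra.
From mathcomp Require Import all_classical all_reals all_analysis.
From mathcomp Require Import ring lra.
Set Implicit Arguments. Unset Strict Implicit. Unset Printing Implicit Defensive.
Import Order.TTheory GRing.Theory Num.Theory.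
Import numFieldNormedType.Exports.
Local Open Scope ring_scope.

(** * Integrals of polynomials over a segment *)

Lemma horner_integrable (R : realType) (a b : R) (p : {poly R}) :
  (@lebesgue_measure R).-integrable `[a, b]%classic (EFin \o horner p).
Proof.
apply: continuous_compact_integrable; first exact: segment_compact.
by apply: continuous_subspaceT => x; exact: continuous_horner.
Qed.

(** Keeping the integrands polynomial makes integrability on a segment automatic, so linearity
    carries no side condition. *)
Lemma Rintegral_horner_sum (R : realType) (a b : R) (I : finType)
  (f : I -> R) (p : I -> {poly R}) :
  Rintegral (@lebesgue_measure R) `[a, b]%classic
    (fun t => \sum_i f i * (p i).[t]) =
  \sum_i f i * Rintegral (@lebesgue_measure R) `[a, b]%classic (horner (p i)).
Proof.
elim: (index_enum I) => [|i s IHs].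
  under eq_Rintegral do rewrite big_nil.
  by rewrite big_nil Rintegral_cst// mul0r.
have hornerE' : forall u, (fun t => \sum_(j <- u) f j * (p j).[t]) =
    horner (\sum_(j <- u) f j *: p j).
  move=> u; apply/funext => t; rewrite horner_sum.
  by apply: eq_bigr => j _; rewrite hornerZ.
under eq_Rintegral do rewrite big_cons -hornerZ.
rewrite big_cons RintegralD//; last 2 first.
- exact: horner_integrable.
- rewrite hornerE'; exact: horner_integrable.
rewrite IHs; congr (_ + _).
under eq_Rintegral do rewrite hornerZ.
by rewrite RintegralZl//; exact: horner_integrable.
Qed.

Lemma Rintegral_deriv (R : realType) (a b : R) (p : {poly R}) : a < b ->
  Rintegral (@lebesgue_measure R) `[a, b]%classic (horner p^`()) =
  p.[b] - p.[a].
Proof.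
move=> ab; rewrite /Rintegral (@continuous_FTC2 _ _ (horner p))//.
- by apply: continuous_subspaceT => x; exact: continuous_horner.
- split.
  + by move=> x _; exact: derivable_horner.
  + by apply: cvg_at_right_filter; exact: continuous_horner.
  + by apply: cvg_at_left_filter; exact: continuous_horner.
- by move=> x _; rewrite derivE.
Qed.

(** * Iterated expectations and moments of the coordinates *)

Lemma coordE_horner_sum (R : realType) (d N : nat) (lam : R) (c : 'I_d)
  (y : 'I_N.+1 -> bool) (k : 'I_N.+1 * 'I_d) (I : finType)
  (f : I -> R) (p : I -> {poly R}) :
  coordE lam c y k (fun t => \sum_i f i * (p i).[t]) =
  \sum_i f i * coordE lam c y k (horner (p i)).
Proof.
rewrite /coordE; case: ifP => // _.
case: (y k.1); rewrite Rintegral_horner_sum mulr_sumr;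
  by apply: eq_bigr => i _; rewrite mulrCA.
Qed.

(** A Fubini rule for sums of products of one-coordinate factors: integrating one coordinate leaves
    all other factors constant. Since [s] has no duplicates, the value [t] given to its head is
    never overwritten. *)
Lemma iterE_sum_prod (R : realType) (d N : nat) (lam : R) (c : 'I_d)
  (y : 'I_N.+1 -> bool) (I : finType) (f : I -> R)
  (p : I -> 'I_N.+1 * 'I_d -> {poly R}) (s : seq ('I_N.+1 * 'I_d)) x0 :
  uniq s ->
  iterE lam c y s
    (fun x => \sum_i f i * \prod_k (p i k).[x k.1 k.2]) x0 =
  \sum_i f i * \prod_k (if k \in s then coordE lam c y k (horner (p i k))
                        else (p i k).[x0 k.1 k.2]).
Proof.
elim: s x0 => [//|k s IHs] x0 /= /andP[ks us].
transitivity (coordE lam c y k (fun t => \sum_i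
   (f i * \prod_(l | l != k) (if l \in s then coordE lam c y l (horner (p i l))
                        else (p i l).[x0 l.1 l.2])) * (p i k).[t])).
  congr coordE; apply/funext => t; rewrite IHs//.
  apply: eq_bigr => i _; rewrite -mulrA; congr (_ * _).
  rewrite (bigD1 k)//= (negbTE ks) -surjective_pairing eqxx mulrC.
  congr (_ * _); apply: eq_bigr => l lk.
  by rewrite -surjective_pairing (negbTE lk).
rewrite coordE_horner_sum; apply: eq_bigr => i _; rewrite -mulrA.
congr (_ * _); rewrite [RHS](bigD1 k)//= mem_head mulrC.
by congr (_ * _); apply: eq_bigr => l lk; rewrite inE (negbTE lk).
Qed.

(** The closed form of the loss holds only where every [y * x] is nonnegative. [coordE] evaluates
    its argument only at points of that sign, so agreement there suffices. *)
Lemma iterE_congr (R : realType) (d N : nat) (lam : R) (c : 'I_d)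
  (y : 'I_N.+1 -> bool) (s : seq ('I_N.+1 * 'I_d)) F G x0 :
  (forall x, (forall n i, (n, i) \in s -> 0 <= ysgn R (y n) * x n i) ->
             (forall n i, (n, i) \notin s -> x n i = x0 n i) -> F x = G x) ->
  iterE lam c y s F x0 = iterE lam c y s G x0.
Proof.
elim: s x0 => [|k s IHs] x0 FG /=; first exact: FG.
have step t : 0 <= ysgn R (y k.1) * t ->
    iterE lam c y s F (fun n i => if (n, i) == k then t else x0 n i) =
    iterE lam c y s G (fun n i => if (n, i) == k then t else x0 n i).
  move=> t0; apply: IHs => x xs xNs; apply: FG => n i.
    rewrite inE; have [nis _|nis] := boolP ((n, i) \in s); first exact: xs.
    rewrite orbF => nik; rewrite xNs// nik.
    by move: t0; rewrite -(eqP nik).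
  by rewrite inE negb_or => /andP[/negbTE nik nis]; rewrite xNs// nik.
rewrite /coordE; case: ifP => _.
  by apply: step; rewrite /ysgn; case: ifP; rewrite ?mulr1 ?mulrNN ?mulr1.
congr (_ * _); apply: eq_Rintegral => t.
rewrite /ysgn in step *; case: (y k.1) step => step; rewrite inE/= in_itv/= => /andP[t0 t1];
  apply: step; by [rewrite mul1r|rewrite mulN1r oppr_ge0].
Qed.

(* The m-th moment of [y * x_i] under the task [c]; it does not depend on [y]. *)
Definition moment (R : realType) (d : nat) (lam : R) (c i : 'I_d) (m : nat) : R :=
  if i == c then 1 else lam ^+ m / m.+1%:R.

Lemma moment0 (R : realType) (d : nat) (lam : R) (c i : 'I_d) :
  moment lam c i 0 = 1.
Proof. by rewrite /moment expr0 divr1 if_same. Qed.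

Lemma coordE_exp (R : realType) (d N : nat) (lam : R) (c : 'I_d)
  (y : 'I_N.+1 -> bool) (k : 'I_N.+1 * 'I_d) (m : nat) : 0 < lam ->
  coordE lam c y k (horner ((ysgn R (y k.1) *: 'X) ^+ m)) = moment lam c k.2 m.
Proof.
move=> lam0; rewrite /coordE /moment; case: ifP => _.
  by rewrite !hornerE /ysgn; case: (y _); rewrite ?mulr1 ?mulrNN ?mulr1 expr1n.
have m0 : m.+1%:R != 0 :> R by rewrite pnatr_eq0.
have -> : (ysgn R (y k.1) *: 'X) ^+ m =
    (((ysgn R (y k.1)) ^+ m / m.+1%:R) *: 'X^(m.+1))^`() :> {poly R}.
  by rewrite derivZ derivXn exprZn -scalerMnr scalerMnl -mulr_natr divfK.
have e : lam^-1 * lam ^+ m.+1 = lam ^+ m by rewrite exprS mulKf// gt_eqF.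
rewrite /ysgn; case: (y k.1); rewrite Rintegral_deriv ?oppr_lt0// !hornerE.
  by rewrite expr1n expr0n/= mulr0 subr0 mul1r mulrCA e mulrC.
rewrite expr0n/= mulr0 sub0r [(- lam) ^+ _]exprNn.
(* On [[-lam, 0]] the sign in the integrand and the sign of the endpoint cancel, which gives the
   same moment as on [[0, lam]]. *)
transitivity ((-1) ^+ m * (-1) ^+ m * (lam^-1 * lam ^+ m.+1) / m.+1%:R).
  rewrite [(-1) ^+ m.+1]exprS.
  by move: ((-1) ^+ m) (lam ^+ m.+1) lam^-1 (m.+1%:R^-1) => s t u v; ring.
by rewrite e -exprMn mulrNN mulr1 expr1n mul1r.
Qed.

(** * Prompt entries as monomials, and the output of the network *)

(* The entry (k, l) of the outer square of (u, 1), where the i-th factor is the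
   image of [u_i ^ m] under [v i], [m] being the number of occurrences of [i]
   among [k] and [l]; the label index [ord_max] contributes a factor 1. *)
Definition monom2 (R : realType) (d : nat) (v : 'I_d -> nat -> R) (k l : 'I_d.+1) : R :=
  \prod_(i < d) v i ((k == i :> nat) + (l == i :> nat))%N.

Lemma ysgnM (R : realType) b : ysgn R b * ysgn R b = 1.
Proof. by case: b; rewrite /= ?mulr1 ?mulrNN ?mulr1. Qed.

(** For a feature index the label squares to 1 and disappears; for the last index all exponents are
    0 and the label alone remains. *)
Lemma ext_prod (R : realType) (d : nat) (v : 'I_d -> R) (b : bool) (k : 'I_d.+1) :
  ext v (ysgn R b) k =
  ysgn R b * \prod_(i < d) (ysgn R b * v i) ^+ (k == i :> nat).
Proof.
rewrite /ext; case: insubP => [i _ ik|].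
  rewrite (bigD1 i)//= ik eqxx expr1 big1 ?mulr1; last first.
    by move=> j ji; rewrite -ik eq_sym (inj_eq val_inj) (negbTE ji).
  by rewrite mulrA ysgnM mul1r.
rewrite -leqNgt => dk; rewrite big1 ?mulr1// => i _.
by rewrite gtn_eqF// (leq_trans (ltn_ord i)).
Qed.

Lemma ext_mul (R : realType) (d : nat) (v : 'I_d -> R) (b : bool) (k l : 'I_d.+1) :
  ext v (ysgn R b) k * ext v (ysgn R b) l =
  monom2 (fun i m => (ysgn R b * v i) ^+ m) k l.
Proof.
rewrite !ext_prod mulrACA ysgnM mul1r -big_split.
by apply: eq_bigr => i _; rewrite exprD.
Qed.

(** Made for the terms of the risk, whose nontrivial factors lie in the row of one demonstration and
    in a single cell of the query row. *)
Lemma prod_row_cell (R : comPzRingType) (A B : finType) (F : A * B -> R) n m j :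
  n != m -> (forall a b, a != n -> (a, b) != (m, j) -> F (a, b) = 1) ->
  \prod_k F k = (\prod_b F (n, b)) * F (m, j).
Proof.
move=> nm F1; transitivity (\prod_a \prod_b F (a, b)).
  by rewrite pair_bigA; apply: eq_bigr => -[].
rewrite (bigD1 n)//=; congr (_ * _).
rewrite (bigD1 m) /=; last by rewrite eq_sym.
rewrite [X in _ * X]big1 ?mulr1; last first.
  by move=> a /andP[an am]; apply: big1 => b _; rewrite F1// xpair_eqE (negbTE am).
rewrite (bigD1 j)//= big1 ?mulr1// => b bj.
by rewrite F1 1?[m == n]eq_sym// xpair_eqE (negbTE bj) andbF.
Qed.

Lemma widen_ord_neq_max (d : nat) (k : 'I_d) : widen_ord (leqnSn d) k != ord_max.
Proof. by rewrite -val_eqE/= ltn_eqF. Qed.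

(** The entry [(ord_max, j)] of [P Z M Z^T Q / N], expanded so that each summand is a monomial in a
    single demonstration. *)
Definition query_weight (R : realType) (d N : nat) (P Q : 'M[R]_d.+1)
  (x : 'I_N.+1 -> 'I_d -> R) (y : 'I_N.+1 -> bool) (j : 'I_d) : R :=
  \sum_k \sum_l \sum_(n < N) N%:R^-1 *
     (P ord_max k * Q l (widen_ord (leqnSn d) j)) *
     let n' := widen_ord (leqnSn N) n in
     monom2 (fun i m => (ysgn R (y n') * x n' i) ^+ m) k l.

(** The last column of [Q] drops out because the query carries label entry 0, and the mask keeps the
    query out of [Z M Z^T], so the weights do not depend on [D]. *)
Lemma ftf_entry (R : realType) (d N : nat) (P Q : 'M[R]_d.+1)
  (x : 'I_N.+1 -> 'I_d -> R) (y : 'I_N.+1 -> bool) (D : 'I_d -> R) :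
  ftf P Q (Zmat x y D) ord_max ord_max =
  \sum_(j < d) query_weight P Q x y j
    * (x ord_max j + D j).
Proof.
have Z0 : Zmat x y D ord_max ord_max = 0.
  by rewrite mxE eqxx /ext insubF//= ltnn.
have Zj j : Zmat x y D (widen_ord (leqnSn d) j) ord_max = x ord_max j + D j.
  by rewrite mxE eqxx /ext/= valK.
rewrite /ftf mxE [X in _ * X]mxE big_ord_recr/= Z0 mulr0 addr0.
rewrite mulr_sumr; apply: eq_bigr => j _.
rewrite Zj mulrA /query_weight; congr (_ * _).
rewrite mxE mulr_sumr [RHS]exchange_big/=; apply: eq_bigr => l _.
rewrite mxE big_ord_recr/=.
have MP (n : 'I_N.+1) : (P *m Zmat x y D *m Mmat R N) ord_max n =
    if n == ord_max then 0 else \sum_k P ord_max k * Zmat x y D k n.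
  rewrite mxE (bigD1 n)//= big1 ?addr0; last first.
    by move=> a an; rewrite [Mmat _ _ _ _]mxE (negbTE an) mulr0.
  rewrite [Mmat _ _ _ _]mxE eqxx /=.
  by case: (n == ord_max); rewrite /= ?mulr0// mulr1 mxE.
rewrite MP eqxx mul0r addr0 mulr_suml mulr_sumr exchange_big/=.
apply: eq_bigr => n _; rewrite MP (negbTE (widen_ord_neq_max _)) mulr_suml mulr_suml mulr_sumr.
apply: eq_bigr => k _; rewrite [_^T _ _]mxE ![Zmat _ _ _ _ _]mxE (negbTE (widen_ord_neq_max _)).
rewrite -ext_mul; ring.
Qed.

Lemma monom2_ge0 (R : realType) (d : nat) (v : 'I_d -> nat -> R) k l :
  (forall i m, 0 <= v i m) -> 0 <= monom2 v k l.
Proof. by move=> v0; apply: prodr_ge0. Qed.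

(** * The worst-case loss and its expectation *)

(** With nonnegative weights a single sign of the perturbation is best for all coordinates at once,
    so the supremum is attained. *)
Lemma adv_loss_support (R : realType) (d N : nat) (eps : R) (P Q : 'M[R]_d.+1)
  (x : 'I_N.+1 -> 'I_d -> R) (y : 'I_N.+1 -> bool) :
  0 <= eps -> in01 P -> in01 Q ->
  (forall n i, 0 <= ysgn R (y n) * x n i) ->
  adv_loss eps P Q x y =
  \sum_(j < d) query_weight P Q x y j
    * (eps - ysgn R (y ord_max) * x ord_max j).
Proof.
move=> eps0 P01 Q01 xy.
set a := query_weight P Q x y.
have a0 j : 0 <= a j.
  apply: sumr_ge0 => k _; apply: sumr_ge0 => l _; apply: sumr_ge0 => n _.
  have /andP[? _] := P01 ord_max k; have /andP[? _] := Q01 l (widen_ord (leqnSn d) j).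
  rewrite !mulr_ge0 ?invr_ge0//; apply: monom2_ge0 => i m.
  exact: exprn_ge0.
rewrite /adv_loss; set E := (X in sup X).
have s2 := ysgnM R (y ord_max).
set v := \sum_(j < d) _.
have vE : E v.
  exists (fun _ => - ysgn R (y ord_max) * eps); split.
    move=> _; rewrite mulNr normrN normrM (ger0_norm eps0) /ysgn.
    by case: ifP; rewrite ?normrN normr1 mul1r.
  rewrite ftf_entry mulr_sumr; apply: eq_bigr => j _; rewrite -/(a j).
  transitivity (a j * (ysgn R (y ord_max) * ysgn R (y ord_max) * eps - ysgn R (y ord_max) * x ord_max j)); last by ring.
  by rewrite s2 mul1r.
have vub : ubound E v.
  move=> _ [D [De ->]]; rewrite ftf_entry mulr_sumr; apply: ler_sum => j _.
  rewrite -/(a j) mulrCA ler_wpM2l// mulrDr addrC lerD//; last by rewrite mulNr.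
  rewrite (le_trans (ler_norm _))// normrM.
  suff -> : `|- ysgn R (y ord_max)| = 1 by rewrite mul1r.
  by rewrite /ysgn normrN; case: ifP; rewrite ?normrN normr1.
apply/eqP; rewrite eq_le; apply/andP; split.
  by apply: ge_sup => //; exists v.
by apply: ub_le_sup => //; exists v.
Qed.

(** One summand of the loss as a product of one-coordinate polynomials, together with its
    expectation. The demonstration [n'] is never the query, so the two kinds of factor do not
    meet. *)
Lemma iterE_poly (R : realType) (d N : nat) (lam : R) (c : 'I_d)
  (y : 'I_N.+1 -> bool) (n : 'I_N) (k l : 'I_d.+1) (j : 'I_d) (eps : R) : 0 < lam ->
  let n' := widen_ord (leqnSn N) n in
  let p (q : 'I_N.+1 * 'I_d) : {poly R} :=
    if q == (ord_max, j) then eps%:P - ysgn R (y ord_max) *: 'X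
    else if q.1 == n' then
      (ysgn R (y n') *: 'X) ^+ ((k == q.2 :> nat) + (l == q.2 :> nat))
    else 1 in
  (forall x, \prod_q (p q).[x q.1 q.2] =
    monom2 (fun i m => (ysgn R (y n') * x n' i) ^+ m) k l *
      (eps - ysgn R (y ord_max) * x ord_max j)) /\
  \prod_q coordE lam c y q (horner (p q)) =
    monom2 (moment lam c) k l * (eps - moment lam c j 1).
Proof.
move=> lam0 n' p.
have nmax : n' != ord_max by exact: widen_ord_neq_max.
have pn i : p (n', i) =
    (ysgn R (y n') *: 'X) ^+ ((k == i :> nat) + (l == i :> nat)).
  by rewrite /p xpair_eqE (negbTE nmax)/= eqxx.
have pj : p (ord_max, j) = eps%:P - ysgn R (y ord_max) *: 'X.
  by rewrite /p eqxx.
have p1 a b : a != n' -> (a, b) != (ord_max, j) -> p (a, b) = 1.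
  by rewrite /p => /negbTE an /negbTE ->; rewrite an.
split=> [x|]; rewrite (prod_row_cell (j := j) nmax) /=.
- rewrite pj !hornerE; congr (_ * _); apply: eq_bigr => i _.
  by rewrite pn !hornerE.
- by move=> a b an abj; rewrite p1// hornerE.
- rewrite pj; congr (_ * _).
    by apply: eq_bigr => i _; rewrite pn coordE_exp.
  (* The affine query factor is split over [bool]: exponent 0 with coefficient [eps], exponent 1
     with coefficient [-1]. *)
  have := @coordE_horner_sum R d N lam c y (ord_max, j) bool
    (fun b => if b then eps else -1)
    (fun b => (ysgn R (y ord_max) *: 'X) ^+ ~~ b).
  rewrite big_bool/= !(coordE_exp _ _ (ord_max, j)) //=.
  rewrite moment0 mulr1 => e; rewrite mulN1r in e.
  rewrite -e; congr coordE; apply/funext => t.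
  rewrite big_bool /= expr0 expr1 !hornerE.
  by rewrite -[RHS]/(eps + -1 * ysgn R (y ord_max) * t) mulN1r mulNr.
- move=> a b an abj; rewrite p1//.
  have := @coordE_exp R d N lam c y (a, b) 0 lam0.
  by rewrite moment0 expr0.
Qed.

Lemma sum_quad (V : nmodType) (A B C D : finType) (F : A * B * C * D -> V) :
  \sum_t F t = \sum_a \sum_b \sum_c \sum_e F (a, b, c, e).
Proof. by rewrite !pair_bigA; apply: eq_bigr => -[[[a b] c] e]. Qed.

(** All demonstrations contribute the same moments, so the factor [N^-1] absorbs their number and
    the risk no longer depends on [N]. *)
Lemma adv_riskE (R : realType) (d N : nat) (lam eps : R) (P Q : 'M[R]_d.+1) :
  (0 < N)%N -> 0 < lam -> 0 <= eps -> in01 P -> in01 Q ->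
  adv_risk N lam eps P Q =
  d%:R^-1 * \sum_(j < d) \sum_k \sum_l
     P ord_max k * Q l (widen_ord (leqnSn d) j) *
     \sum_(c < d) (monom2 (moment lam c) k l * (eps - moment lam c j 1)).
Proof.
move=> N0 lam0 eps0 P01 Q01; rewrite /adv_risk; congr (_ * _).
transitivity (\sum_(c < d) \sum_(j < d) \sum_k \sum_l
     P ord_max k * Q l (widen_ord (leqnSn d) j) *
     (monom2 (moment lam c) k l * (eps - moment lam c j 1))); last first.
  rewrite exchange_big; apply: eq_bigr => j _.
  rewrite exchange_big; apply: eq_bigr => k _.
  rewrite exchange_big; apply: eq_bigr => l _.
  by rewrite mulr_sumr.
apply: eq_bigr => c _.
set V := RHS.
(* [V] does not mention the labels, so it equals its own average over them and the comparison can be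
   made for each [y] separately. *)
transitivity ((2 ^+ N.+1)^-1 * \sum_(y : {ffun 'I_N.+1 -> bool}) V); last first.
  by rewrite sumr_const card_ffun card_bool card_ord -[V *+ _]mulr_natl natrX mulKf.
congr (_ * _); apply: eq_bigr => y _.
rewrite (@iterE_congr _ _ _ _ _ _ _ _ (fun x => \sum_(j < d) query_weight P Q x y j
    * (eps - ysgn R (y ord_max) * x ord_max j))); last first.
  move=> x xs _; apply: adv_loss_support => // n i.
  by apply: xs; rewrite mem_enum in_setT.
pose p (t : 'I_d * 'I_d.+1 * 'I_d.+1 * 'I_N) (q : 'I_N.+1 * 'I_d) : {poly R} :=
    if q == (ord_max, t.1.1.1) then eps%:P - ysgn R (y ord_max) *: 'X
    else if q.1 == widen_ord (leqnSn N) t.2 then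
      (ysgn R (y (widen_ord (leqnSn N) t.2)) *: 'X) ^+
         ((t.1.1.2 == q.2 :> nat) + (t.1.2 == q.2 :> nat))
    else 1.
pose f (t : 'I_d * 'I_d.+1 * 'I_d.+1 * 'I_N) : R :=
  N%:R^-1 * (P ord_max t.1.1.2 * Q t.1.2 (widen_ord (leqnSn d) t.1.1.1)).
rewrite (_ : (fun x => _) = (fun x => \sum_t f t * \prod_q (p t q).[x q.1 q.2])).
  rewrite iterE_sum_prod ?enum_uniq//.
  transitivity (\sum_t f t * (monom2 (moment lam c) t.1.1.2 t.1.2 * (eps - moment lam c t.1.1.1 1))).
    apply: eq_bigr => t _; congr (_ * _).
    rewrite -(iterE_poly c y t.2 _ _ _ _ lam0).2.
    by apply: eq_bigr => q _; rewrite mem_enum in_setT.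
  rewrite sum_quad /=.
  apply: eq_bigr => j _; apply: eq_bigr => k _; apply: eq_bigr => l _.
  rewrite /f/= sumr_const card_ord -[LHS]mulr_natl !mulrA divff ?mul1r//.
  by rewrite pnatr_eq0 -lt0n.
apply/funext => x.
transitivity (\sum_t f t * (monom2 (fun i m => (ysgn R (y (widen_ord (leqnSn N) t.2)) *
   x (widen_ord (leqnSn N) t.2) i) ^+ m) t.1.1.2 t.1.2 *
   (eps - ysgn R (y ord_max) * x ord_max t.1.1.1))); last first.
  apply: eq_bigr => t _; congr (_ * _).
  by rewrite -(iterE_poly c y t.2 _ _ _ _ lam0).1.
  rewrite sum_quad /=.
apply: eq_bigr => j _; rewrite mulr_suml; apply: eq_bigr => k _.
rewrite mulr_suml; apply: eq_bigr => l _; rewrite mulr_suml.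
by apply: eq_bigr => n _; rewrite /f/= mulrA.
Qed.

(** * Entries of the risk form *)

(** Stated as an elimination principle, to separate the label index from the features by [elim/]. *)
Lemma ord_widen_max (d : nat) (P : 'I_d.+1 -> Prop) :
  P ord_max -> (forall i, P (widen_ord (leqnSn d) i)) -> forall k, P k.
Proof.
move=> Pm Pw k; have [kd|dk] := ltnP k d.
  suff -> : k = widen_ord (leqnSn d) (Ordinal kd) by [].
  exact: val_inj.
suff -> : k = ord_max by [].
by apply: val_inj; apply/eqP; rewrite eqn_leq dk -ltnS ltn_ord.
Qed.

Lemma monom2C (R : realType) (d : nat) (v : 'I_d -> nat -> R) k l :
  monom2 v k l = monom2 v l k.
Proof. by apply: eq_bigr => i _; rewrite addnC. Qed.

Lemma monom2_max (R : realType) (d : nat) (v : 'I_d -> nat -> R) :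
  (forall i, v i 0 = 1) -> monom2 v ord_max ord_max = 1.
Proof. by move=> v0; apply: big1 => i _; rewrite gtn_eqF. Qed.

Lemma monom2_max_widen (R : realType) (d : nat) (v : 'I_d -> nat -> R) i :
  (forall i, v i 0 = 1) -> monom2 v ord_max (widen_ord (leqnSn d) i) = v i 1.
Proof.
move=> v0; rewrite /monom2 (bigD1 i)//= gtn_eqF// eqxx big1 ?mulr1// => j ji.
by rewrite gtn_eqF// eq_sym (inj_eq val_inj) (negbTE ji).
Qed.

Lemma monom2_widen (R : realType) (d : nat) (v : 'I_d -> nat -> R) i :
  (forall i, v i 0 = 1) ->
  monom2 v (widen_ord (leqnSn d) i) (widen_ord (leqnSn d) i) = v i 2.
Proof.
move=> v0; rewrite /monom2 (bigD1 i)//= eqxx big1 ?mulr1// => j ji.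
by rewrite eq_sym (inj_eq val_inj) (negbTE ji).
Qed.

Lemma monom2_widen_neq (R : realType) (d : nat) (v : 'I_d -> nat -> R) i k :
  (forall i, v i 0 = 1) -> i != k ->
  monom2 v (widen_ord (leqnSn d) i) (widen_ord (leqnSn d) k) = v i 1 * v k 1.
Proof.
move=> v0 ik; rewrite /monom2 (bigD1 i)//= (bigD1 k) 1?eq_sym//= !eqxx.
rewrite !(inj_eq val_inj) (negbTE ik) big1 ?mulr1//.
move=> j /andP[ji jk].
by rewrite !(inj_eq val_inj) ![_ == j]eq_sym (negbTE ji) (negbTE jk).
Qed.

(** The matrix [W_j]: second moments of a demonstration times the expected value of [eps - y * x_j]
    at the query, summed over tasks. *)
Definition risk_coef (R : realType) (d : nat) (lam eps : R) (j : 'I_d)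
    (k l : 'I_d.+1) : R :=
  \sum_(c < d) monom2 (moment lam c) k l * (eps - moment lam c j 1).

Lemma risk_coefC (R : realType) (d : nat) (lam eps : R) (j : 'I_d) k l :
  risk_coef lam eps j k l = risk_coef lam eps j l k.
Proof. by apply: eq_bigr => c _; rewrite monom2C. Qed.

Lemma risk_coef_mono (R : realType) (d : nat) (lam eps eps' : R) (j : 'I_d) k l :
  0 < lam -> eps <= eps' -> risk_coef lam eps j k l <= risk_coef lam eps' j k l.
Proof.
move=> lam0 ee; apply: ler_sum => c _; apply: ler_wpM2l; last by rewrite lerB.
apply: monom2_ge0 => i m; rewrite /moment; case: ifP => // _.
by rewrite divr_ge0// exprn_ge0// ltW.
Qed.

Lemma moment_delta (R : realType) (d : nat) (lam : R) (c i : 'I_d) m :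
  moment lam c i m = lam ^+ m / m.+1%:R + (1 - lam ^+ m / m.+1%:R) * (c == i)%:R.
Proof. by rewrite /moment eq_sym; case: eqP => _; rewrite ?mulr1 ?mulr0; ring. Qed.

Lemma sum_delta (R : realType) (d : nat) (i : 'I_d) (f : 'I_d -> R) :
  \sum_c f c * (c == i)%:R = f i.
Proof.
rewrite (bigD1 i)//= eqxx mulr1 big1 ?addr0// => c /negbTE ->.
by rewrite mulr0.
Qed.

(** The mean of [y * x_j] is [lam / 2], except under task [j], where it is larger by
    [1 - lam / 2]. *)
Lemma risk_coefE (R : realType) (d : nat) (lam eps : R) (j : 'I_d) k l :
  risk_coef lam eps j k l =
  (eps - lam / 2) * (\sum_c monom2 (moment lam c) k l)
  - (1 - lam / 2) * monom2 (moment lam j) k l.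
Proof.
rewrite -(sum_delta j (fun c => monom2 (moment lam c) k l)).
rewrite !mulr_sumr -sumrB; apply: eq_bigr => c _.
rewrite moment_delta expr1; ring.
Qed.

Lemma sum_moment (R : realType) (d : nat) (lam : R) (i : 'I_d) m :
  \sum_c moment lam c i m = 1 + (d%:R - 1) * (lam ^+ m / m.+1%:R).
Proof.
under eq_bigr do rewrite moment_delta.
by rewrite big_split/= sum_delta sumr_const card_ord -mulr_natl; ring.
Qed.

Lemma risk_coef_max (R : realType) (d : nat) (lam eps : R) (j : 'I_d) :
  risk_coef lam eps j ord_max ord_max = (eps - lam / 2) * d%:R - (1 - lam / 2).
Proof.
rewrite risk_coefE (eq_bigr (fun=> 1)) => [|c _].
  rewrite sumr_const card_ord monom2_max ?mulr1// => i; exact: moment0.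
by apply: monom2_max => i; exact: moment0.
Qed.

Lemma risk_coef_max_widen (R : realType) (d : nat) (lam eps : R) (j i : 'I_d) :
  risk_coef lam eps j ord_max (widen_ord (leqnSn d) i) =
  (eps - lam / 2) * (1 + (d%:R - 1) * (lam / 2)) - (1 - lam / 2) * moment lam j i 1.
Proof.
rewrite risk_coefE (eq_bigr (fun c => moment lam c i 1)) => [|c _].
  rewrite sum_moment monom2_max_widen ?expr1// => l; exact: moment0.
by apply: monom2_max_widen => l; exact: moment0.
Qed.

Lemma risk_coef_widen (R : realType) (d : nat) (lam eps : R) (j i : 'I_d) :
  risk_coef lam eps j (widen_ord (leqnSn d) i) (widen_ord (leqnSn d) i) =
  (eps - lam / 2) * (1 + (d%:R - 1) * (lam ^+ 2 / 3)) - (1 - lam / 2) * moment lam j i 2.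
Proof.
rewrite risk_coefE (eq_bigr (fun c => moment lam c i 2)) => [|c _].
  rewrite sum_moment monom2_widen// => l; exact: moment0.
by apply: monom2_widen => l; exact: moment0.
Qed.

Lemma moment_neq (R : realType) (d : nat) (lam : R) (j i : 'I_d) m :
  i != j -> moment lam j i m = lam ^+ m / m.+1%:R.
Proof. by rewrite /moment => /negbTE ->. Qed.

Lemma moment_diag (R : realType) (d : nat) (lam : R) (j : 'I_d) m :
  moment lam j j m = 1.
Proof. by rewrite /moment eqxx. Qed.

Lemma risk_coef_widen_neq (R : realType) (d : nat) (lam eps : R) (j i k : 'I_d) :
  i != k ->
  risk_coef lam eps j (widen_ord (leqnSn d) i) (widen_ord (leqnSn d) k) =
  (eps - lam / 2) * (lam / 2 * (2 + (d%:R - 2) * (lam / 2)))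
    - (1 - lam / 2) * (moment lam j i 1 * moment lam j k 1).
Proof.
move=> ik; have m0 c := @moment0 R d lam c.
(* Only the moment of [k] is expanded into a constant and a delta; the delta sits at task [k], where
   the moment of [i] is [lam / 2]. *)
rewrite risk_coefE (eq_bigr (fun c => lam / 2 * moment lam c i 1 +
   (1 - lam / 2) * moment lam c i 1 * (c == k)%:R)) => [|c _].
  rewrite big_split/= sum_delta -mulr_sumr sum_moment monom2_widen_neq//.
  by rewrite (moment_neq lam 1 ik) expr1; congr (_ - _); ring.
by rewrite monom2_widen_neq// [moment _ _ k _]moment_delta expr1; ring.
Qed.

Lemma natr_ge2 (R : realType) (d : nat) (i k : 'I_d) : i != k -> 2 <= d%:R :> R.
Proof.
case: d i k => [[]//|[|d]] i k; first by rewrite !ord1 eqxx.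
by rewrite ler_nat.
Qed.

Lemma natr_ge1 (R : realType) (d : nat) (i : 'I_d) : 1 <= d%:R :> R.
Proof. by case: d i => [[]//|d] _; rewrite ler1n. Qed.

(** * Large [eps]: all entries are nonnegative *)

(** The hypothesis is nonnegativity of the entry [(j, j)]. There the ratio of the sum over all tasks
    to the value under task [j] is smallest, which [main] turns into a bound for the other
    entries. *)
Lemma risk_coef_ge0 (R : realType) (d : nat) (lam eps : R) (j : 'I_d) k l :
  0 < lam -> lam < 1 ->
  1 - lam / 2 <= (eps - lam / 2) * (1 + (d%:R - 1) * (lam ^+ 2 / 3)) ->
  0 <= risk_coef lam eps j k l.
Proof.
move=> lam0 lam1.
have hq : lam ^+ 2 / 3 <= lam / 2 by nra.
have q0 : 0 <= lam ^+ 2 / 3 by nra.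
have h1 : lam / 2 < 1 / 2 by lra.
have h0 : 0 < lam / 2 by lra.
have h2 : lam / 2 * (lam / 2) <= lam / 2 by nra.
have D1 := natr_ge1 R j.
have P1 : 0 <= (d%:R - 1) * (lam / 2) * (1 - lam ^+ 2 / 3).
  by rewrite !mulr_ge0//; lra.
suff main T S : 0 <= S -> (1 + (d%:R - 1) * (lam ^+ 2 / 3)) * S <= T ->
    1 - lam / 2 <= (eps - lam / 2) * (1 + (d%:R - 1) * (lam ^+ 2 / 3)) ->
    0 <= (eps - lam / 2) * T - (1 - lam / 2) * S.
  move=> He; elim/ord_widen_max: k => [|i]; elim/ord_widen_max: l => [|k].
  - rewrite risk_coef_max -[X in _ - X]mulr1; apply: main => //.
    move: (d%:R) (lam ^+ 2 / 3) D1 q0 hq => D q ? ? ?; nra.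
  - rewrite risk_coef_max_widen; apply: main => //.
      by rewrite /moment; case: ifP => _ //; rewrite expr1 ltW.
    have [->|kj] := eqVneq k j; first rewrite moment_diag.
      move: (d%:R) (lam ^+ 2 / 3) D1 q0 hq => D q ? ? ?; nra.
    rewrite moment_neq// expr1.
    move: (d%:R) (lam ^+ 2 / 3) (lam / 2) D1 q0 hq h0 h1 P1 => D q h ? ? ? ? ? ?; nra.
  - rewrite risk_coefC risk_coef_max_widen; apply: main => //.
      by rewrite /moment; case: ifP => _ //; rewrite expr1 ltW.
    have [->|kj] := eqVneq i j; first rewrite moment_diag.
      move: (d%:R) (lam ^+ 2 / 3) D1 q0 hq => D q ? ? ?; nra.
    rewrite moment_neq// expr1.
    move: (d%:R) (lam ^+ 2 / 3) (lam / 2) D1 q0 hq h0 h1 P1 => D q h ? ? ? ? ? ?; nra.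
  have [->|ik] := eqVneq i k.
    rewrite risk_coef_widen; apply: main => //.
      by rewrite /moment; case: ifP.
    have [->|kj] := eqVneq k j; first by rewrite moment_diag mulr1.
    rewrite moment_neq// ler_piMr//; first by nra.
    by lra.
  rewrite risk_coef_widen_neq//; have D2 := natr_ge2 R ik.
  have m01 a : 0 <= moment lam j a 1 <= 1.
    by rewrite /moment; case: ifP => _; rewrite ?ler01 ?lexx ?expr1//; apply/andP; split; lra.
  apply: main => //; first by have := m01 i; have := m01 k; nra.
  (* At least one of [i] and [k] differs from [j], so the product of the moments is at most
     [lam / 2]. *)
  apply: (@le_trans _ _ ((1 + (d%:R - 1) * (lam ^+ 2 / 3)) * (lam / 2))); last first.
    rewrite mulrC; apply: ler_wpM2l; first by lra.
    move: (d%:R) (lam ^+ 2 / 3) (lam / 2) D2 q0 hq h0 h1 => D q h ? ? ? ? ?; nra.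
  apply: ler_wpM2l; first by nra.
  have [ij|ij] := eqVneq i j.
    have kj : k != j by rewrite -ij eq_sym.
    by rewrite ij moment_diag mul1r (moment_neq _ _ kj) expr1.
  rewrite (moment_neq _ _ ij) expr1 ler_piMr//; first by lra.
  by have /andP[] := m01 k.
move=> S0 TS He; rewrite subr_ge0.
apply: (@le_trans _ _ ((eps - lam / 2) * (1 + (d%:R - 1) * (lam ^+ 2 / 3)) * S)).
  exact: ler_wpM2r.
rewrite -mulrA; apply: ler_wpM2l => //.
have A0 : 0 < 1 + (d%:R - 1) * (lam ^+ 2 / 3).
  by rewrite ltr_wpDr// mulr_ge0// subr_ge0.
by apply: ltW; rewrite -(pmulr_lgt0 _ A0) (lt_le_trans _ He)//; lra.
Qed.

(** * Small [eps]: the all-one solution *)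

(* Raising [p] and [q] to 1 on [B] only lowers the form; once [q] is 1 on [B],
   every row sum of [q_l W_kl] is nonpositive, so [p] and then [q] can be raised
   to 1 everywhere. *)
Lemma all_one_minimizes (R : realType) (I : finType) (B : pred I)
  (W W' : I -> I -> R) (p q : I -> R) :
  (forall k l, W k l = W l k) -> (forall k l, W k l <= W' k l) ->
  (forall k l, B k -> W' k l <= 0) ->
  (forall k l, ~~ B k -> ~~ B l -> 0 <= W' k l) ->
  (forall k, ~~ B k -> \sum_l W' k l <= 0) ->
  (forall k, 0 <= p k <= 1) -> (forall k, 0 <= q k <= 1) ->
  \sum_k \sum_l W k l <= \sum_k \sum_l p k * q l * W k l.
Proof.
move=> Wsym WW' W'B W'NB W'row p01 q01.
have WB k l : B k -> W k l <= 0 by move=> Bk; rewrite (le_trans (WW' _ _))// W'B.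
pose r (u : I -> R) k := if B k then 1 else u k.
have r01 u : (forall k, 0 <= u k <= 1) -> forall k, 0 <= r u k <= 1.
  by move=> u01 k; rewrite /r; case: ifP => _ //; rewrite ler01 lexx.
have row u k : (forall k, 0 <= u k <= 1) -> \sum_l r u l * W k l <= 0.
  move=> u01; have [Bk|NBk] := boolP (B k).
    apply: sumr_le0 => l _; have /andP[? _] := r01 _ u01 l.
    by rewrite mulr_ge0_le0// WB.
  (* Off [B] the entries of [W'] in this row are nonnegative, so replacing [r u l] by 1 only
     increases the sum, up to the full row sum of [W']. *)
  apply: le_trans (W'row _ NBk); apply: ler_sum => l _.
  have /andP[rl0 rl1] := r01 _ u01 l.
  apply: (@le_trans _ _ (r u l * W' k l)); first exact: ler_wpM2l.
  have [Bl|NBl] := boolP (B l); first by rewrite /r Bl mul1r.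
  by rewrite ler_piMl// W'NB.
apply: (@le_trans _ _ (\sum_k \sum_l r p k * r q l * W k l)); last first.
  apply: ler_sum => k _; apply: ler_sum => l _.
  have /andP[pk0 pk1] := p01 k; have /andP[ql0 ql1] := q01 l.
  rewrite /r; have [Bk|NBk] := boolP (B k).
    by apply: ler_wnM2r; [exact: WB|rewrite mul1r; case: ifP => _; rewrite ?ler_piMl// mulr_ile1].
  have [Bl|NBl] := boolP (B l); last by [].
  by apply: ler_wnM2r; [rewrite Wsym WB|rewrite ler_wpM2l].
apply: (@le_trans _ _ (\sum_k \sum_l r q l * W k l)); last first.
  apply: ler_sum => k _; under [leRHS]eq_bigr do rewrite -mulrA.
  rewrite -mulr_sumr; have /andP[_ rk1] := r01 _ p01 k.
  by move: (row _ k q01) rk1; move: (\sum_l _) (r p k) => s a; nra.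
rewrite [leLHS]exchange_big [leRHS]exchange_big/=; apply: ler_sum => l _.
rewrite -mulr_sumr; have /andP[_ rl1] := r01 _ q01 l.
have : \sum_k W k l <= 0.
  rewrite (eq_bigr (fun k => r (fun=> 1) k * W l k)) => [|k _].
    by apply: row => k; rewrite ler01 lexx.
  by rewrite /r if_same mul1r Wsym.
move: (\sum_k _) => s s0; nra.
Qed.

(* Comparison with the threshold value of [eps], at which the off-[B] entries
   are nonnegative. *)
Lemma std_coef_min (R : realType) (d : nat) (lam eps : R) (j : 'I_d)
  (p q : 'I_d.+1 -> R) :
  0 < lam -> lam < 1 ->
  eps <= lam * (lam * (d%:R - 2) + 4) / (2 * (lam * (d%:R - 1) + 2)) ->
  (forall k, 0 <= p k <= 1) -> (forall k, 0 <= q k <= 1) ->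
  \sum_k \sum_l risk_coef lam eps j k l <=
  \sum_k \sum_l p k * q l * risk_coef lam eps j k l.
Proof.
move=> lam0 lam1; set eps0 := _ / _ => epsle p01 q01.
have D1 := natr_ge1 R j.
have h0 : 0 < lam / 2 by lra.
have h1 : lam / 2 < 1 / 2 by lra.
have hq : lam ^+ 2 / 3 <= lam / 2 by nra.
have q0 : 0 <= lam ^+ 2 / 3 by nra.
have qh : (lam / 2) ^+ 2 <= lam ^+ 2 / 3 by nra.
pose D := 1 + (d%:R - 1) * (lam / 2).
have D0 : 0 < D by rewrite ltr_wpDr// mulr_ge0 ?subr_ge0// ltW.
have P1 : 0 <= (d%:R - 1) * (lam / 2) * (1 - lam ^+ 2 / 3).
  by rewrite !mulr_ge0//; lra.
(* The threshold is the value at which the entries pairing the label with a feature other than [j]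
   vanish; [D] is the first moment of a feature summed over tasks. *)
have delta : (eps0 - lam / 2) * D = (1 - lam / 2) * (lam / 2).
  rewrite /eps0 /D; field.
  have -> : lam * (d%:R - 1) + 2 = 2 * D by rewrite /D; field.
  by rewrite mulf_neq0// gt_eqF.
have neg T S : T * (lam / 2) <= S * D ->
    (eps0 - lam / 2) * T - (1 - lam / 2) * S <= 0.
  move=> TS; rewrite -(pmulr_lle0 _ D0) mulrBl mulrAC delta; nra.
have pos T S : S * D <= T * (lam / 2) ->
    0 <= (eps0 - lam / 2) * T - (1 - lam / 2) * S.
  move=> TS; rewrite -(pmulr_lge0 _ D0) mulrBl mulrAC delta; nra.
pose B (k : 'I_d.+1) := (k == ord_max) || (k == widen_ord (leqnSn d) j).
have BwE i : B (widen_ord (leqnSn d) i) = (i == j).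
  by rewrite /B (negbTE (widen_ord_neq_max i)) /= -val_eqE.
have negm k : risk_coef lam eps0 j ord_max k <= 0.
  elim/ord_widen_max: k => [|i].
    rewrite risk_coef_max -[X in _ - X]mulr1; apply: neg; rewrite /D; nra.
  rewrite risk_coef_max_widen; apply: neg; rewrite -/D.
  have [->|ij] := eqVneq i j; first by rewrite moment_diag; nra.
  by rewrite moment_neq// expr1 mulrC.
have negj k : risk_coef lam eps0 j (widen_ord (leqnSn d) j) k <= 0.
  elim/ord_widen_max: k => [|i]; first by rewrite risk_coefC.
  have [->|ij] := eqVneq i j.
    rewrite risk_coef_widen; apply: neg; rewrite moment_diag /D; nra.
  have D2 := natr_ge2 R ij.
  rewrite risk_coef_widen_neq 1?eq_sym//; apply: neg.
  rewrite moment_diag mul1r moment_neq// expr1 -mulrA; apply: ler_wpM2l.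
    exact: ltW.
  rewrite /D; nra.
(* The entries of row [i] are written with deltas at [j] and at [i], so that the row sum follows
   from [sum_delta]. *)
have gE i l : i != j -> risk_coef lam eps0 j (widen_ord (leqnSn d) i) (widen_ord (leqnSn d) l) * D =
    (1 - lam / 2) * ((lam / 2) ^+ 2 * (1 - lam / 2)
      - (lam / 2) * (1 - lam / 2) * D * (l == j)%:R
      + (lam / 2 - lam ^+ 2 / 3 - (lam / 2) ^+ 2 * (1 - lam / 2)) * (l == i)%:R).
  move=> ij; have [->|li] := eqVneq l i.
    rewrite (negbTE ij) risk_coef_widen moment_neq//= mulrBl mulrAC delta /D; ring.
  rewrite risk_coef_widen_neq 1?eq_sym// mulrBl mulrAC delta.
  rewrite (moment_neq _ _ ij) expr1; have [->|lj] := eqVneq l j.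
    by rewrite moment_diag /D /=; ring.
  by rewrite (moment_neq _ _ lj) expr1 /D /=; ring.
apply: (all_one_minimizes (B := B) (W' := risk_coef lam eps0 j)) => //.
- exact: risk_coefC.
- by move=> k l; apply: risk_coef_mono.
- by move=> k l; rewrite /B => /orP[] /eqP ->.
- move=> k l; elim/ord_widen_max: k => [|i]; first by rewrite /B eqxx.
  elim/ord_widen_max: l => [|k]; first by rewrite /B eqxx.
  rewrite !BwE => ij kj; have [->|ik] := eqVneq i k.
    rewrite risk_coef_widen; apply: pos; rewrite moment_neq// /D; nra.
  have D2 := natr_ge2 R ik.
  rewrite risk_coef_widen_neq//; apply: pos.
  rewrite (moment_neq _ _ ij) (moment_neq _ _ kj) expr1 /D -subr_ge0.
  rewrite [leRHS](_ : _ = (lam / 2) ^+ 2 * (1 - lam / 2)); last by ring.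
  by rewrite mulr_ge0 ?sqr_ge0//; lra.
- elim/ord_widen_max => [|i]; first by rewrite /B eqxx.
  rewrite BwE => ij; rewrite big_ord_recr/= -(pmulr_lle0 _ D0) mulrDl.
  rewrite [X in _ + X](_ : _ = 0); last first.
    rewrite risk_coefC risk_coef_max_widen moment_neq// expr1 mulrBl -/D mulrAC delta; ring.
  rewrite addr0 mulr_suml (eq_bigr _ (fun l _ => gE i l ij)).
  rewrite -mulr_sumr mulr_ge0_le0//; first by lra.
  rewrite big_split/= sumrB !sum_delta sumr_const card_ord -(mulr_natl _ d).
  (* What remains is the squared mean minus the second moment of a uniform coordinate, that is,
     minus its variance. *)
  by rewrite [leLHS](_ : _ = (lam / 2) ^+ 2 - lam ^+ 2 / 3) ?subr_le0// /D; ring.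
Qed.

(** * The middle value of [eps]: the diagonal solution *)

Lemma sum_neq_const (R : realType) (d : nat) (j : 'I_d) (x : R) :
  \sum_(k < d | k != j) x = (d%:R - 1) * x.
Proof.
have : \sum_(k < d) x = d%:R * x by rewrite sumr_const card_ord mulr_natl.
by rewrite (bigD1 j)//= => e; rewrite mulrBl -e; ring.
Qed.

Lemma sum_neq2_const (R : realType) (d : nat) (j l : 'I_d) (x : R) : l != j ->
  \sum_(k < d | (k != j) && (k != l)) x = (d%:R - 2) * x.
Proof.
move=> lj; have := sum_neq_const j x; rewrite (bigD1 l)//= => e.
have -> : (d%:R - 2) * x = (d%:R - 1) * x - x by ring.
by rewrite -e; ring.
Qed.

(* Tight when all [p k] are 1 and [q] is the indicator of [j]; the slack
   is nonnegative only after summation over [j]. *)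
Lemma adv_coef_min (R : realType) (d : nat) (lam eps : R) (j : 'I_d)
  (p q : 'I_d.+1 -> R) (w := widen_ord (leqnSn d)) :
  0 < lam -> lam < 1 ->
  eps = (1 + (d%:R - 1) * (lam / 2)) / d%:R ->
  (forall k, 0 <= p k <= 1) -> (forall k, 0 <= q k <= 1) ->
  \sum_k risk_coef lam eps j k (w j) +
    (1 - lam / 2) / d%:R *
    ((d%:R - 1) * (1 - lam ^+ 2 / 3) * (1 - p (w j))
      - (1 - lam / 2) * \sum_(k < d | k != j) (1 - p (w k))) <=
  \sum_k \sum_l p k * q l * risk_coef lam eps j k l.
Proof.
move=> lam0 lam1 epsE p01 q01.
have D1 := natr_ge1 R j.
have dn0 : d%:R != 0 :> R by rewrite gt_eqF// (lt_le_trans _ D1).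
have h0 : 0 < lam / 2 by lra.
have h1 : lam / 2 < 1 / 2 by lra.
have hq : lam ^+ 2 / 3 <= lam / 2 by nra.
have q0 : 0 <= lam ^+ 2 / 3 by nra.
pose K := (1 - lam / 2) / d%:R.
have K0 : 0 <= K by rewrite divr_ge0//; lra.
have epsK : eps - lam / 2 = K by rewrite epsE /K; field.
have Kd : 1 - lam / 2 = K * d%:R by rewrite /K divfK.
have p1 k : 0 <= 1 - p k by have /andP[_ ?] := p01 k; rewrite subr_ge0.
pose E := \sum_(k < d | k != j) (1 - p (w k)).
rewrite -/K -/E.
pose q3 := lam ^+ 2 / 3; pose h := lam / 2.
have Vmm : risk_coef lam eps j ord_max ord_max = 0.
  by rewrite risk_coef_max epsK Kd subrr.
have Vmj : risk_coef lam eps j ord_max (w j) = - (K * (1 - h) * (d%:R - 1)).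
  by rewrite risk_coef_max_widen moment_diag epsK {1}Kd /h; ring.
have Vmk k : k != j -> risk_coef lam eps j ord_max (w k) = K * (1 - h).
  by move=> kj; rewrite risk_coef_max_widen moment_neq// expr1 epsK {1}Kd /h; ring.
have Vjj : risk_coef lam eps j (w j) (w j) = - (K * (1 - q3) * (d%:R - 1)).
  by rewrite risk_coef_widen moment_diag epsK {1}Kd /q3; ring.
have Vkj k : k != j ->
    risk_coef lam eps j (w k) (w j) = - (K * h * (1 - h) * (d%:R - 2)).
  move=> kj; rewrite risk_coef_widen_neq// moment_diag moment_neq// expr1.
  by rewrite epsK {1}Kd /h; ring.
have Vkk k : k != j -> risk_coef lam eps j (w k) (w k) = K * (1 - q3).
  by move=> kj; rewrite risk_coef_widen moment_neq// epsK {1}Kd /q3; ring.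
have Vkl k l : k != j -> l != j -> k != l ->
    risk_coef lam eps j (w k) (w l) = K * h * (1 - h) * 2.
  move=> kj lj kl; rewrite risk_coef_widen_neq// (moment_neq _ _ kj).
  by rewrite (moment_neq _ _ lj) expr1 epsK {1}Kd /h; ring.
rewrite -/q3 -/h in hq q0 h0 h1 *.
have col_max : - (K * (1 - h) * E) <=
    \sum_k p k * q ord_max * risk_coef lam eps j k ord_max.
  rewrite big_ord_recr/= Vmm mulr0 addr0 (bigD1 j)//= risk_coefC Vmj.
  (* The single negative entry is spread evenly over the [d - 1] positive ones, so that they can be
     compared pairwise. *)
  have -> : p (w j) * q ord_max * - (K * (1 - h) * (d%:R - 1)) =
      \sum_(k < d | k != j) - (K * (1 - h) * (p (w j) * q ord_max)).
    by rewrite sum_neq_const; ring.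
  rewrite -big_split/= /E mulr_sumr -sumrN; apply: ler_sum => k kj.
  rewrite risk_coefC Vmk//.
  rewrite [leRHS](_ : _ = K * (1 - h) *
     (q ord_max * (p (w k) - p (w j)))); last by rewrite /w; ring.
  rewrite -mulrN; apply: ler_wpM2l; first by rewrite mulr_ge0//; lra.
  have /andP[? ?] := q01 ord_max; have /andP[? ?] := p01 (w k).
  by have /andP[? ?] := p01 (w j); nra.
(* Every entry of column [j] is nonpositive, so [q (w j) = 1] is best there and lowering any [p k]
   costs; the cost of lowering the label entry of [p] is discarded. *)
have col_diag : \sum_k risk_coef lam eps j k (w j) +
     K * ((d%:R - 1) * (1 - q3) * (1 - p (w j)) + h * (1 - h) * (d%:R - 2) * E) <=
    \sum_k p k * q (w j) * risk_coef lam eps j k (w j).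
  have negk k : risk_coef lam eps j k (w j) <= 0.
    elim/ord_widen_max: k => [|k].
      by rewrite Vmj oppr_le0 !mulr_ge0//; lra.
    have [->|kj] := eqVneq k j; first by rewrite Vjj oppr_le0 !mulr_ge0//; lra.
    have D2 := natr_ge2 R kj.
    by rewrite Vkj// oppr_le0 !mulr_ge0//; lra.
  apply: (@le_trans _ _ (\sum_k (risk_coef lam eps j k (w j) +
      (1 - p k) * (- risk_coef lam eps j k (w j))))); last first.
    apply: ler_sum => k _; have := negk k; move: (risk_coef _ _ _ _ _) => r r0.
    have /andP[? ?] := q01 (w j); have /andP[? ?] := p01 k.
    rewrite [leLHS](_ : _ = p k * r); last by ring.
    by rewrite ler_wnM2r// ler_piMr.
  rewrite big_split/= lerD2l big_ord_recr/= (bigD1 j)//= Vjj.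
  rewrite [\sum_(i < d | _) _](_ : _ = K * (h * (1 - h) * (d%:R - 2) * E)); last first.
    by rewrite !mulr_sumr; apply: eq_bigr => k kj; rewrite Vkj// /w; ring.
  rewrite ler_wpDr//; first by rewrite mulr_ge0// oppr_ge0.
  by rewrite /w le_eqVlt; apply/orP; left; apply/eqP; ring.
have col_off l : l != j ->
    - (K * h * (1 - h) * (E - (1 - p (w l)))) <=
    \sum_k p k * q (w l) * risk_coef lam eps j k (w l).
  move=> lj; rewrite big_ord_recr/= (bigD1 j)//= (bigD1 l)//=.
  rewrite Vmk// Vkk// risk_coefC Vkj// /E (bigD1 l)//=.
  rewrite [X in - (_ * X)](_ : _ = \sum_(k < d | (k != j) && (k != l)) (1 - p (w k))); last by ring.
  have /andP[? ?] := q01 (w l); have /andP[? ?] := p01 (w j).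
  have /andP[? ?] := p01 (w l); have /andP[? ?] := p01 ord_max.
  have -> : p (w j) * q (w l) * - (K * h * (1 - h) * (d%:R - 2)) =
      \sum_(k < d | (k != j) && (k != l)) - (K * h * (1 - h) * (p (w j) * q (w l))).
    by rewrite sum_neq2_const//; ring.
  (* The label entry and the diagonal entry of the column are nonnegative and are dropped. *)
  rewrite ler_wpDr//; first by rewrite !mulr_ge0//; lra.
  rewrite addrCA ler_wpDl//; first by rewrite !mulr_ge0//; lra.
  rewrite -big_split/= mulr_sumr -sumrN; apply: ler_sum => k /andP[kj kl].
  rewrite Vkl// [leRHS](_ : _ = K * h * (1 - h) *
     (q (w l) * (2 * p (w k) - p (w j)))); last by rewrite /w; ring.
  rewrite -mulrN; apply: ler_wpM2l; first by rewrite !mulr_ge0//; lra.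
  by have /andP[? ?] := p01 (w k); nra.
rewrite [leRHS]exchange_big/= [leRHS]big_ord_recr/= [X in _ <= X + _](bigD1 j)//=.
(* The possible gain in these columns is cancelled exactly by the [(d - 2) * E] term of
   [col_diag]. *)
have col_offs : - (K * h * (1 - h) * (d%:R - 2) * E) <=
   \sum_(l < d | l != j) \sum_k p k * q (w l) * risk_coef lam eps j k (w l).
  apply: le_trans _ (ler_sum _ col_off).
  rewrite sumrN -mulr_sumr sumrB sum_neq_const -/E le_eqVlt; apply/orP; left.
  by apply/eqP; ring.
apply: le_trans _ (lerD (lerD col_diag col_offs) col_max).
by rewrite le_eqVlt; apply/orP; left; apply/eqP; ring.
Qed.

(** * Assembly of the three regimes *)

Lemma adv_risk_sub (R : realType) (d N : nat) (lam eps : R) (P Q P' Q' : 'M[R]_d.+1) :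
  (0 < N)%N -> 0 < lam -> 0 <= eps -> in01 P -> in01 Q -> in01 P' -> in01 Q' ->
  let w := widen_ord (leqnSn d) in
  \sum_(j < d) \sum_k \sum_l
    P ord_max k * Q l (w j) * risk_coef lam eps j k l <=
  \sum_(j < d) \sum_k \sum_l
    P' ord_max k * Q' l (w j) * risk_coef lam eps j k l ->
  adv_risk N lam eps P Q <= adv_risk N lam eps P' Q'.
Proof.
move=> N0 lam0 eps0 P01 Q01 P01' Q01' w le.
by rewrite !adv_riskE// ler_wpM2l// invr_ge0.
Qed.

Theorem theorem3p2 (R : realType) (d N : nat) (lam eps : R) :
  (0 < d)%N -> (0 < N)%N -> 0 < lam -> lam < 1 -> 0 <= eps ->
  (eps <= lam * (lam * (d%:R - 2) + 4) / (2 * (lam * (d%:R - 1) + 2)) ->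
     is_global_min N lam eps (Pstd R d) (Qstd R d)) /\
  (eps = (1 + (d%:R - 1) * (lam / 2)) / d%:R ->
     is_global_min N lam eps (Pstd R d) (Qadv R d)) /\
  (lam / 2 + 3 / 2 * ((2 - lam) / ((d%:R - 1) * lam ^+ 2 + 3)) <= eps ->
     is_global_min N lam eps (0 : 'M[R]_(d.+1)) 0).
Proof.
move=> d0 N0 lam0 lam1 eps0.
have if01 (b : bool) : 0 <= (if b then 1 else 0 : R) <= 1.
  by case: b; rewrite ?lexx ?ler01.
have Pstd01 : in01 (Pstd R d) by move=> i k; rewrite mxE.
have Qstd01 : in01 (Qstd R d).
  by move=> i k; rewrite mxE; case: ifP; rewrite ?lexx ?ler01.
have Qadv01 : in01 (Qadv R d) by move=> i k; rewrite mxE.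
have zero01 : in01 (0 : 'M[R]_d.+1) by move=> i k; rewrite mxE lexx ler01.
split; [|split].
- move=> epsle; split=> //; split=> // P Q P01 Q01.
  apply: adv_risk_sub => //=; apply: ler_sum => j _.
  rewrite (eq_bigr (fun k => \sum_l risk_coef lam eps j k l)) => [|k _].
    exact: std_coef_min.
  apply: eq_bigr => l _; rewrite !mxE eqxx -val_eqE/= ltn_eqF//.
  by rewrite !mul1r.
- move=> epsE; split=> //; split=> // P Q P01 Q01.
  apply: adv_risk_sub => //=; set w := widen_ord (leqnSn d).
  apply: le_trans (ler_sum _ (fun j _ => adv_coef_min j lam0 lam1 epsE (P01 ord_max) (fun k => Q01 k (w j)))).
  rewrite big_split/= -/w.
  rewrite [leLHS](_ : _ = \sum_(j < d) \sum_k risk_coef lam eps j k (w j)); last first.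
    apply: eq_bigr => j _; apply: eq_bigr => k _; rewrite (bigD1 (w j))//= big1.
      by rewrite !mxE !eqxx widen_ord_neq_max mul1r mul1r addr0.
    by move=> l lj; rewrite !mxE (negbTE lj) mulr0 mul0r.
  rewrite lerDl -mulr_sumr mulr_ge0//.
    by rewrite divr_ge0//; lra.
  pose S := \sum_(k < d) (1 - P ord_max (w k)).
  have S0 : 0 <= S.
    by apply: sumr_ge0 => k _; have /andP[_ ?] := P01 ord_max (w k); rewrite subr_ge0.
  have D1 : 1 <= d%:R :> R by rewrite ler1n.
  rewrite sumrB -!mulr_sumr -/S.
  (* Each feature [k] is counted once for every [j] other than [k]. *)
  have -> : \sum_(j < d) \sum_(k < d | k != j) (1 - P ord_max (w k)) =
      (d%:R - 1) * S.
    rewrite (eq_bigr (fun j => S - (1 - P ord_max (w j)))) => [|j _].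
      by rewrite sumrB sumr_const card_ord -/S mulrBl mul1r mulr_natl.
    by rewrite /S [X in _ = X - _](bigD1 j)//= [RHS]addrC addKr.
  (* The total slack has the sign of [lam / 2 - lam ^+ 2 / 3], which is positive for [lam] between 0
     and 1. *)
  rewrite [leRHS](_ : _ = (d%:R - 1) * S * (lam / 2 - lam ^+ 2 / 3)); last by ring.
  by rewrite !mulr_ge0//; nra.
- move=> epsge; split=> //; split=> // P Q P01 Q01.
  apply: adv_risk_sub => //=; apply: ler_sum => j _.
  apply: ler_sum => k _; apply: ler_sum => l _.
  rewrite !mxE !mul0r; have /andP[? _] := P01 ord_max k.
  have /andP[? _] := Q01 l (widen_ord (leqnSn d) j).
  rewrite !mulr_ge0// risk_coef_ge0//.
  have D1 : 1 <= d%:R :> R by rewrite ler1n.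
  have A0 : 0 < (d%:R - 1) * lam ^+ 2 + 3.
    by rewrite ltr_wpDl// mulr_ge0 ?subr_ge0// sqr_ge0.
  (* At the threshold itself this product equals [1 - lam / 2], so the entry [(j, j)] is exactly 0
     there. *)
  apply: (@le_trans _ _ (3 / 2 * ((2 - lam) / ((d%:R - 1) * lam ^+ 2 + 3)) *
     (1 + (d%:R - 1) * (lam ^+ 2 / 3)))).
    rewrite le_eqVlt; apply/orP; left; apply/eqP; field.
    by rewrite gt_eqF.
  by apply: ler_wpM2r; nra.
Qed.
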